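(* Let $n\ge 1$, let $a=(a_1,\ldots,a_n)$ and $b=(b_1,\ldots,b_n)$ be two $n$-tuples of positive integers, and let $X\subseteq\mathbb{N}$. Let $S\in\mathcal{N}(a,b,X)$ and let $m\in\mathrm{msg}(S)$. Then $S\setminus\{m\}\in\mathcal{N}(a,b,X)$ if and only if $\frac{m-b_i}{a_i}\notin S\setminus\{0\}$ for all $i\in\{1,\ldots,n\}$ and $m\notin X$.
   Context: $\mathbb{N}$ is the set of non-negative integers. A numerical semigroup is a submonoid $S$ of $(\mathbb{N},+)$ with $\mathbb{N}\setminus S$ finite. $\mathrm{msg}(S)$ denotes the (unique) minimal system of generators of $S$, i.e. $\mathrm{msg}(S)=(S\setminus\{0\})\setminus\big((S\setminus\{0\})+(S\setminus\{0\})\big)$. For $s\in\mathbb{N}$, $as+b=(a_1s+b_1,\ldots,a_ns+b_n)$. $\mathcal{N}(a,b,X)$ is the set of all numerical semigroups $S$ such that $X\subseteq S$ and $as+b\in S^n$ for all $s\in S\setminus\{0\}$. The quotient $\frac{m-b_i}{a_i}$ is a rational number (it may fail to be an integer or be negative, in which case it is not in $S\setminus\{0\}$). *)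

(* Defs.v *)
From mathcomp Require Import all_boot all_order all_algebra.
From mathcomp Require Import boolp classical_sets cardinality.

Set Implicit Arguments.
Unset Strict Implicit.
Unset Printing Implicit Defensive.

Local Open Scope classical_set_scope.

Definition submonoid (S : set nat) : Prop :=
  S 0 /\ (forall x y : nat, S x -> S y -> S (x + y)).

Definition numerical_semigroup (S : set nat) : Prop :=
  submonoid S /\ finite_set (~` S).

(* The minimal system of generators: the nonzero elements of S that are not
   sums of two nonzero elements of S. *)
Definition msg (S : set nat) : set nat :=
  (S `\ 0) `\` [set x + y | x in S `\ 0 & y in S `\ 0].

Definition affine_tuple (n : nat) (a b : n.-tuple nat) (s : nat) :
    n.-tuple nat :=
  [tuple tnth a i * s + tnth b i | i < n].

Definition set_power (n : nat) (S : set nat) : set (n.-tuple nat) :=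
  [set t | forall i : 'I_n, S (tnth t i)].
Arguments set_power : clear implicits.

(* The family N(a, b, X). *)
Definition semigroup_family (n : nat) (a b : n.-tuple nat) (X : set nat) :
    set (set nat) :=
  [set S | [/\ numerical_semigroup S, X `<=` S &
    forall s : nat, (S `\ 0) s -> set_power n S (affine_tuple a b s)]].
Arguments semigroup_family {n} a b X _.

Definition rat_image (A : set nat) : set rat := [set (k%:R)%R | k in A].

(* Main.v *)
Require Import Defs.
From mathcomp Require Import all_boot all_order all_algebra.
From mathcomp Require Import boolp classical_sets cardinality.

Local Open Scope classical_set_scope.

(** Since [m] is irreducible, [S \ {m}] is again a numerical semigroup, and it contains [X] exactly
    when [m] is not in [X]. Closure under the affine maps can break only if some nonzero [s] in [S]
    has [a_i s + b_i = m], that is, if the quotient lies in [S \ {0}]. Such an [s] is smaller than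
    [m], so it survives the removal and really is an obstruction. *)

(** Clearing the denominator in the rationals leaves an equation in [nat], free of divisibility and
    sign conditions. *)
Lemma rat_image_affineE (A : set nat) (m c d : nat) : 0 < c ->
  rat_image A (((m%:R - d%:R) / c%:R : rat)%R) <->
  exists2 k, A k & c * k + d = m.
Proof.
move=> c0; have cN0 : (c%:R != 0 :> rat)%R by rewrite Num.Theory.pnatr_eq0 -lt0n.
have affE k : (k%:R = (m%:R - d%:R) / c%:R :> rat)%R <-> c * k + d = m.
  split=> [kE|<-]; last first.
    by rewrite GRing.natrD GRing.addrK mulnC GRing.natrM GRing.mulfK.
  apply/eqP; rewrite -(Num.Theory.eqr_nat rat) GRing.natrD mulnC GRing.natrM.
  by rewrite kE GRing.divfK // GRing.subrK.
by split=> -[k Ak /affE kE]; exists k.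
Qed.

(** A sum equal to [m] must have a zero term, so its other term is [m] itself; the complement gains
    a single point. *)
Lemma numerical_semigroupD1 (S : set nat) (m : nat) :
  numerical_semigroup S -> msg S m -> numerical_semigroup (S `\ m).
Proof.
move=> [[S0 SD] Sfin] [[_ m0] mirr]; split; last first.
  by rewrite setDE setCI setCK finite_setU.
split=> [|x y [Sx xm] [Sy ym]]; first by split=> // /esym.
split=> [|xyE]; first exact: SD.
have [x0|x0] := eqVneq x 0; first by apply: ym; rewrite -xyE x0.
have [y0|y0] := eqVneq y 0; first by apply: xm; rewrite -xyE y0 addn0.
by apply: mirr; exists x; [split=> //; exact/eqP|exists y => //; split=> //; exact/eqP].
Qed.

Theorem proposition3p2 (n : nat) (hn : 1 <= n) (a b : n.-tuple nat)
    (ha : forall i : 'I_n, 0 < tnth a i) (hb : forall i : 'I_n, 0 < tnth b i)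
    (X S : set nat) (hS : semigroup_family a b X S)
    (m : nat) (hm : msg S m) :
  semigroup_family a b X (S `\ m) <->
  (forall i : 'I_n,
     ~ rat_image (S `\ 0)
         (((m%:R - (tnth b i)%:R) / (tnth a i)%:R : rat)%R)) /\
  ~ X m.
Proof.
have [Sns XS Sab] := hS; split=> [[_ XSm Smab]|[notim notXm]].
  split=> [i|/XSm [_ /(_ erefl)] //].
  move=> /(rat_image_affineE _ _ _ _ (ha i)) [k [Sk k0] kE].
  (* Here [a_i >= 1] and [b_i > 0] give [k < a_i k + b_i = m], so the closure of [S \ {m}] applies
     to [k]. *)
  have km : k <> m.
    move=> km; have := leq_pmull k (ha i).
    by rewrite leqNgt -[X in _ < X]/k {2}km -kE -addn1 leq_add2l hb.
  have := Smab k (conj (conj Sk km) k0) i.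
  by rewrite tnth_mktuple kE => -[_ /(_ erefl)].
split=> [|x Xx|s [[Ss _] s0] i]; first exact: numerical_semigroupD1.
  by split; [exact: XS|move=> xm; apply: notXm; rewrite -xm].
split; first exact: Sab.
(* If the image of [s] were [m], then [s] would be the excluded quotient. *)
rewrite tnth_mktuple => sE; apply: (notim i).
by apply/(rat_image_affineE _ _ _ _ (ha i)); exists s.
Qed.
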